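(* Let $S$ be a smooth closed surface of genus at least $2$ with a hyperbolic metric $g_0$, and let $\Phi$ be a holomorphic quadratic differential on $(S,g_0)$. Let $v=\frac{1}{3}\frac{|\Phi|^2}{g_0^2}$. Then $v$ is a subsolution of the equation $(\Delta-2)f=-\frac{2|\Phi|^2}{g_0^2}$, that is, $$(\Delta-2)v\ge-\frac{2|\Phi|^2}{g_0^2},$$ and in particular $$0\le v\le-2(\Delta-2)^{-1}\left(\frac{|\Phi|^2}{g_0^2}\right).$$
   Context: Hyperbolic metrics have constant curvature $-1$. In a conformal coordinate $z=x+iy$ the metric is $g_0|dz|^2$, $\Delta=\frac{1}{g_0}(\partial_x^2+\partial_y^2)$ is its Laplace-Beltrami operator, and for $\Phi=\phi\,dz^2$ the function $\frac{|\Phi|^2}{g_0^2}$ is $|\phi|^2/g_0^2$. $(\Delta-2)^{-1}$ is the inverse of $\Delta-2$ acting on functions on $S$. *)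

(* Defs.v *)
From mathcomp Require Import all_boot all_order all_algebra.
From mathcomp Require Import all_classical all_reals all_analysis.
From mathcomp Require Import complex.

Set Implicit Arguments.
Unset Strict Implicit.
Unset Printing Implicit Defensive.

Import Order.TTheory GRing.Theory Num.Theory.
Import numFieldNormedType.Exports.
Import ComplexField.Normc.

Local Open Scope classical_set_scope.
Local Open Scope ring_scope.
Local Open Scope complex_scope.

(* The complex plane; the suffix ^o selects the structure of a normed space over
   the field R[i] itself, for which [derivable] is complex differentiability. *)
Notation plane R := (R[i]^o).

Section PlaneCalculus.
Context {R : realType}.
Local Notation C := (plane R).
Implicit Types (F : C -> R) (U : set C) (z : C).

(* Partial derivatives in z = x + i y, as derivatives at 0 along the lines
   t |-> z + t and t |-> z + i t. *)
Definition partial_x F z : R := derive1 (fun t : R => F (z + Complex t 0)) 0.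
Definition partial_y F z : R := derive1 (fun t : R => F (z + Complex 0 t)) 0.

Definition plane_laplacian F z : R :=
  partial_x (partial_x F) z + partial_y (partial_y F) z.

(* Meant for open U: all partial derivatives of F of order at most n exist and
   are continuous on U. *)
Fixpoint cont_diff_on (n : nat) U F : Prop :=
  (forall z, U z -> {for z, continuous F}) /\
  if n is m.+1 then
    [/\ forall z, U z -> derivable (fun t : R => F (z + Complex t 0)) 0 1,
        forall z, U z -> derivable (fun t : R => F (z + Complex 0 t)) 0 1,
        cont_diff_on m U (partial_x F) &
        cont_diff_on m U (partial_y F)]
  else True.

Definition smooth_on U F : Prop := forall n, cont_diff_on n U F.

(* Smooth and complex differentiable, as for holomorphic sections of smooth
   complex line bundles. *)
Definition holomorphic_on U (f : C -> C) : Prop :=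
  [/\ smooth_on U (fun z => complex.Re (f z)),
      smooth_on U (fun z => complex.Im (f z)) &
      forall z, U z -> derivable f z 1].

Definition complex_derivative (f : C -> C) z : C :=
  derive1 f z.

(* The Gauss curvature at z of the metric g |dz|^2. *)
Definition gauss_curvature (g : C -> R) z : R :=
  - plane_laplacian (fun w => ln (g w)) z / (2 * g z).

End PlaneCalculus.

Section Genus.
Context (R : realType) (S : topologicalType).

Definition simple_closed_curve (c : R -> S) : Prop :=
  [/\ {within `[0, 1], continuous c}, c 0 = c 1 &
      {in `[0, 1[ &, injective c}].

(* n pairwise disjoint simple closed curves that do not disconnect S. *)
Definition nonseparating_curves (n : nat) : Prop :=
  exists c : 'I_n -> R -> S,
    [/\ forall k, simple_closed_curve (c k),
        forall k l, k <> l -> c k @` `[0, 1] `&` c l @` `[0, 1] = set0 &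
        connected (~` \bigcup_k (c k @` `[0, 1]))].

(* For a connected orientable surface, the genus is the maximal number of
   disjoint simple closed curves that do not disconnect it. *)
Definition has_genus (n : nat) : Prop :=
  nonseparating_curves n /\ forall m, nonseparating_curves m -> (m <= n)%N.

End Genus.

(* An atlas of conformal coordinates. [chart i] and [chart_inv i] are total
   functions, meaningful only on [chart_dom i] and on its image; [chart_at p]
   is a chosen chart around p. *)
Record conformal_atlas (R : realType) (S : topologicalType) := ConformalAtlas {
  chart_index : Type;
  chart_dom : chart_index -> set S;
  chart : chart_index -> S -> plane R;
  chart_inv : chart_index -> plane R -> S;
  chart_at : S -> chart_index;
  chart_atP : forall p, chart_dom (chart_at p) p;
  chart_dom_open : forall i, open (chart_dom i);
  chart_image_open : forall i, open (chart i @` chart_dom i);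
  chartK : forall i p, chart_dom i p -> chart_inv i (chart i p) = p;
  chart_continuous : forall i p,
    chart_dom i p -> {for p, continuous (chart i)};
  chart_inv_continuous : forall i p,
    chart_dom i p -> {for chart i p, continuous (chart_inv i)};
  chart_transition : forall i j,
    holomorphic_on (chart i @` (chart_dom i `&` chart_dom j))
                   (chart j \o chart_inv i) }.

Section Tensors.
Context {R : realType} {S : topologicalType} (A : conformal_atlas R S).
Local Notation C := (plane R).

Definition chart_image (i : chart_index A) : set C :=
  chart i @` chart_dom i.

Definition transition_derivative (i j : chart_index A) (p : S) : C :=
  complex_derivative (chart j \o chart_inv i) (chart i p).

(* The metric is [conf_factor i] |dz|^2 in the i-th coordinate. *)
Record hyperbolic_metric := HyperbolicMetric {
  conf_factor : chart_index A -> C -> R;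
  conf_factor_smooth : forall i, smooth_on (chart_image i) (conf_factor i);
  conf_factor_gt0 : forall i z, chart_image i z -> 0 < conf_factor i z;
  conf_factor_change : forall i j p, chart_dom i p -> chart_dom j p ->
    conf_factor i (chart i p) =
    conf_factor j (chart j p) * normc (transition_derivative i j p) ^+ 2;
  conf_factor_curvature : forall i z, chart_image i z ->
    gauss_curvature (conf_factor i) z = -1 }.

(* The differential is [qd_coef i] dz^2 in the i-th coordinate. *)
Record holomorphic_quadratic_differential := HolomorphicQuadraticDifferential {
  qd_coef : chart_index A -> C -> C;
  qd_coef_holomorphic : forall i, holomorphic_on (chart_image i) (qd_coef i);
  qd_coef_change : forall i j p, chart_dom i p -> chart_dom j p ->
    qd_coef i (chart i p) =
    qd_coef j (chart j p) * transition_derivative i j p ^+ 2 }.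

Definition smooth_fun (f : S -> R) : Prop :=
  forall i, smooth_on (chart_image i) (f \o chart_inv i).

Context (g0 : hyperbolic_metric).

(* |Phi|^2 / g0^2 *)
Definition qd_norm2 (Phi : holomorphic_quadratic_differential) (p : S) : R :=
  let i := chart_at A p in
  normc (qd_coef Phi i (chart i p)) ^+ 2 / conf_factor g0 i (chart i p) ^+ 2.

Definition laplacian (f : S -> R) (p : S) : R :=
  let i := chart_at A p in
  plane_laplacian (f \o chart_inv i) (chart i p) / conf_factor g0 i (chart i p).

Definition laplacian_minus2 (f : S -> R) (p : S) : R :=
  laplacian f p - 2 * f p.

(* f is a subsolution of (Delta - 2) f = h. *)
Definition subsolution (h f : S -> R) : Prop :=
  smooth_fun f /\ forall p, laplacian_minus2 f p >= h p.

(* G is the inverse of Delta - 2 as an operator on the smooth functions. *)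
Definition inverse_laplacian_minus2 (G : (S -> R) -> (S -> R)) : Prop :=
  forall h, smooth_fun h ->
    [/\ smooth_fun (G h), laplacian_minus2 (G h) = h &
        G (laplacian_minus2 h) = h].

End Tensors.

(* [qd_norm2], defined through [chart_at], does not depend on the chart. *)
Lemma qd_norm2E (R : realType) (S : topologicalType) (A : conformal_atlas R S)
    (g0 : hyperbolic_metric A) (Phi : holomorphic_quadratic_differential A)
    (i : chart_index A) (p : S) : chart_dom i p ->
  qd_norm2 g0 Phi p =
  normc (qd_coef Phi i (chart i p)) ^+ 2 / conf_factor g0 i (chart i p) ^+ 2.
Proof.
move=> ip; rewrite /qd_norm2; set j := chart_at A p.
have jp : chart_dom j p by exact: chart_atP.
rewrite (qd_coef_change Phi jp ip).
have gj : 0 < conf_factor g0 j (chart j p).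
  by apply: conf_factor_gt0; exists p.
rewrite (conf_factor_change g0 jp ip) in gj *.
rewrite normcM expr2 normcM -expr2.
set t := normc _ in gj *.
set a := normc _.
have t0 : t ^+ 2 != 0.
  by apply: contraTneq gj => ->; rewrite mulr0 ltxx.
by rewrite !exprMn -expr2 -mulf_div divff ?mulr1// expf_neq0.
Qed.

(* Main.v *)
Require Import Defs.
From mathcomp Require Import all_boot all_order all_algebra.
From mathcomp Require Import all_classical all_reals all_analysis.
From mathcomp Require Import complex.
From mathcomp Require Import ring lra.

Import Order.TTheory GRing.Theory Num.Theory.
Import numFieldNormedType.Exports.
Local Open Scope classical_set_scope.
Local Open Scope ring_scope.

(* In a conformal coordinate put f = phi, g = g0, u = |f|^2 / g^2 and
   V = grad (ln g).  Since Re f and Im f are harmonic and curvature -1 reads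
   lap (ln g) = 2 g, expanding gives
     lap u + 4 g u = (4 / g^2) |f' - c|^2 >= 0,
   where c = f (V_x - i V_y); hence Delta u >= -4 u, also at the zeros of f.  Then
   (Delta - 2) (u / 3) >= -2 u, so f1 = u / 3 + 2 (Delta - 2)^-1 u satisfies
   (Delta - 2) f1 >= 0.  At a maximum of f1 on the compact surface Delta f1 <= 0,
   so that f1 <= 0 everywhere. *)

(** The square is a Bochner term. As V_x - i V_y is twice the z-derivative of ln g, the quantity f'
    - c equals g^2 times the z-derivative of f / g^2, the Chern covariant derivative of Phi. The
    constant -4 is a curvature: away from the zeros of Phi, ln |f|^2 is harmonic and lap (ln g^-2) =
    -4 g, so Delta (ln u) = -4. Since ln u breaks down at the zeros, the quotient itself is
    differentiated twice and the square completed by hand. The factor 1/3 is then forced: for k >=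
    0, (Delta - 2) (k u) >= -6 k u, and this is -2 u for k = 1/3. The definitions provide
    derivatives along the two coordinate lines, not a total derivative. Harmonicity of Re f and Im f
    is therefore built from one-variable calculus: Cauchy-Riemann by restricting the complex
    derivative to lines, and equality of mixed partials by the mean value theorem. *)

Section Lines.
Context {R : realType}.
Local Notation C := (plane R).
Implicit Types (d e : R -> C) (F G : C -> R) (U : set C) (z : C).

(** Additive and continuous, hence real-linear. Abstracting the direction lets each fact be proved
    once for both coordinates, and lets the two directions be exchanged in the argument on mixed
    partials. *)
Definition is_line d : Prop := {morph d : s t / s + t} /\ continuous d.

Definition line_x (t : R) : C := Complex t 0.
Definition line_y (t : R) : C := Complex 0 t.

(** The norm of the plane is valued in [R[i]], so radii are complex numbers; a positive one has
    imaginary part 0, and inequalities reduce to real ones through [normc]. *)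
Lemma norm_normc (z : C) : `|z| = Complex (ComplexField.Normc.normc z) 0.
Proof. by []. Qed.

Lemma is_line_x : is_line line_x.
Proof.
split=> [s t|]; first by rewrite /line_x; apply/eqP; rewrite eq_complex/= addr0 !eqxx.
move=> t; apply/cvgrPdist_lt => e e0.
have [e1 e2] : 0 < complex.Re e /\ complex.Im e = 0 by move: e0; rewrite ltcE/= => /andP[/eqP <-].
near=> s.
rewrite norm_normc/= /line_x subr0 expr0n addr0 sqrtr_sqr ltcE/= e2 eqxx/=.
near: s.
by apply: cvgr_dist_lt => //; exact: cvg_id.
Unshelve. all: by end_near. Qed.

Lemma is_line_y : is_line line_y.
Proof.
split=> [s t|]; first by rewrite /line_y; apply/eqP; rewrite eq_complex/= addr0 !eqxx.
move=> t; apply/cvgrPdist_lt => e e0.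
have [e1 e2] : 0 < complex.Re e /\ complex.Im e = 0 by move: e0; rewrite ltcE/= => /andP[/eqP <-].
near=> s.
rewrite norm_normc/= /line_y subr0 expr0n add0r sqrtr_sqr ltcE/= e2 eqxx/=.
near: s.
by apply: cvgr_dist_lt => //; exact: cvg_id.
Unshelve. all: by end_near. Qed.

Lemma line0 d : is_line d -> d 0 = 0.
Proof.
case=> dD _; have := dD 0 0.
by rewrite addr0 => /eqP; rewrite -subr_eq0 opprD addrA subrr sub0r oppr_eq0 => /eqP.
Qed.

Lemma near_line d U z : is_line d -> open U -> U z ->
  \forall t \near (0 : R), U (z + d t).
Proof.
move=> dl oU Uz.
have : (fun t => z + d t) @ (0:R) --> z + d 0.
  by apply: cvgD; [exact: cvg_cst|exact: dl.2].
rewrite (line0 _ dl) addr0; apply.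
exact: open_nbhs_nbhs.
Qed.

Lemma near_box d e U z : is_line d -> is_line e -> open U -> U z ->
  exists2 r : R, 0 < r & forall s t, `|s| < r -> `|t| < r -> U (z + d s + e t).
Proof.
move=> dl el oU Uz.
have : (fun p : R * R => z + d p.1 + e p.2) @ ((0:R), (0:R)) --> z + d 0 + e 0.
  apply: cvgD; first apply: cvgD; first exact: cvg_cst.
    apply: (@cvg_comp _ _ _ fst d _ (nbhs (0:R))); last exact: dl.2.
    exact: cvg_fst.
  apply: (@cvg_comp _ _ _ snd e _ (nbhs (0:R))); last exact: el.2.
  exact: cvg_snd.
rewrite !line0// !addr0 => /(_ U (open_nbhs_nbhs (conj oU Uz))).
move=> /nbhs_ballP[r /= r0 B]; exists r => // s t sr tr.
by apply: (B (s, t)); split; rewrite /= /ball/= sub0r normrN.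
Qed.

(* [partial_x] and [partial_y] are convertible to [dpartial line_x] and
   [dpartial line_y]. *)
Definition dpartial d F z : R := derive1 (fun t : R => F (z + d t)) 0.

Definition line_derivable d U F : Prop :=
  forall z, U z -> derivable (fun t : R => F (z + d t)) 0 1.

Lemma dpartialP d U F z : line_derivable d U F -> U z ->
  is_derive (0 : R) (1 : R) (fun t => F (z + d t)) (dpartial d F z).
Proof. by move=> dF Uz; rewrite /dpartial derive1E; apply: DeriveDef => //; exact: dF. Qed.

Lemma dpartial_val d F z l :
  is_derive (0 : R) (1 : R) (fun t => F (z + d t)) l -> dpartial d F z = l.
Proof. by move=> [_ <-]; rewrite /dpartial derive1E. Qed.

(** Partials are derivatives at parameter 0, whereas the mean value theorem needs derivatives all
    along a segment. By additivity, moving the parameter to [s] amounts to moving the base point to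
    [z + d s]. *)
Lemma is_derive_line_shift d F z (s l : R) : is_line d ->
  is_derive (0 : R) (1 : R) (fun t => F (z + d s + d t)) l ->
  is_derive s (1 : R) (fun t => F (z + d t)) l.
Proof.
move=> dl [d1 d2].
have E : (fun h : R => h^-1 *: (((fun t => F (z + d t)) \o shift s) (h *: 1) - F (z + d s)))
   = (fun h : R => h^-1 *: (((fun t => F (z + d s + d t)) \o shift 0) (h *: 1) - F (z + d s + d 0))).
  by apply/funext => h /=; rewrite addr0 line0// addr0 -addrA -dl.1 [s + _]addrC.
by apply: DeriveDef; [rewrite /derivable E|rewrite /derive E].
Qed.

Lemma is_derive_line_eq d F G U z l : is_line d -> open U -> U z ->
  (forall w, U w -> F w = G w) ->
  is_derive (0 : R) (1 : R) (fun t => F (z + d t)) l ->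
  is_derive (0 : R) (1 : R) (fun t => G (z + d t)) l.
Proof.
move=> dl oU Uz FG; apply: near_eq_is_derive.
by apply: filterS (near_line _ _ _ dl oU Uz) => t /FG.
Qed.

(** A derivative depends on the germ. Coordinate formulas hold on open chart images, and this is
    what permits their substitution under a derivative. *)
Lemma dpartial_eq d F G U z : is_line d -> open U -> U z ->
  (forall w, U w -> F w = G w) -> dpartial d F z = dpartial d G z.
Proof.
move=> dl oU Uz FG; rewrite /dpartial !derive1E; apply: near_eq_derive.
by apply: filterS (near_line _ _ _ dl oU Uz) => t /FG.
Qed.

Lemma line_derivable_eq d F G U : is_line d -> open U ->
  (forall w, U w -> F w = G w) -> line_derivable d U F -> line_derivable d U G.
Proof.
move=> dl oU FG dF z Uz.
by have [] := is_derive_line_eq _ _ _ _ _ _ dl oU Uz FG (dpartialP _ _ _ _ dF Uz).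
Qed.

End Lines.

(** * Mixed partials and maxima *)

Section SecondOrder.
Context {R : realType}.
Local Notation C := (plane R).
Implicit Types (d e : R -> C) (F G : C -> R) (U : set C) (z : C).

Lemma line_MVT d F z (h : R) : is_line d -> 0 < h ->
  (forall s : R, 0 <= s <= h ->
    derivable (fun t => F (z + d s + d t)) (0 : R) (1 : R)) ->
  exists2 s : R, 0 < s < h & F (z + d h) - F z = dpartial d F (z + d s) * h.
Proof.
move=> dl h0 dF.
have D s : 0 <= s <= h ->
    is_derive s (1 : R) (fun t => F (z + d t)) (dpartial d F (z + d s)).
  move=> sh; apply: is_derive_line_shift => //.
  by rewrite /dpartial derive1E; apply: DeriveDef => //; exact: dF.
have [||s] := @MVT R (fun t => F (z + d t)) (fun t => dpartial d F (z + d t)) 0 h h0.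
- by move=> x; rewrite in_itv/= => /andP[x0 xh]; apply: D; rewrite !ltW.
- apply: derivable_within_continuous => x; rewrite in_itv/= => xh.
  by have [] := D x xh.
by rewrite in_itv/= subr0 line0// addr0 => sh E; exists s.
Qed.

Let second_difference (a b c x : R) : a - b - (c - x) = a - c - (b - x).
Proof. by ring. Qed.

(* Both mixed partials take a common value, namely the second difference of F
   over h ^+ 2, somewhere in each small box at z. *)
Lemma dpartialC d e U F z : is_line d -> is_line e -> open U -> U z ->
  line_derivable d U F -> line_derivable e U F ->
  line_derivable d U (dpartial e F) -> line_derivable e U (dpartial d F) ->
  {for z, continuous (dpartial d (dpartial e F))} ->
  {for z, continuous (dpartial e (dpartial d F))} ->
  dpartial d (dpartial e F) z = dpartial e (dpartial d F) z.
Proof.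
move=> dl el oU Uz dF eF deF edF cde ced.
(* Two uses of the mean value theorem: along [d'] for the difference of F across the step [e' h],
   then along [e'] for [dpartial d' F]. The directions are generic because both orders are needed
   below. *)
have key d' e' (r h : R) : is_line d' -> is_line e' ->
    (forall s t, `|s| < r -> `|t| < r -> U (z + d' s + e' t)) ->
    line_derivable d' U F -> line_derivable e' U (dpartial d' F) ->
    0 < h -> h < r ->
    exists s t : R, [/\ 0 < s < h, 0 < t < h &
      F (z + d' h + e' h) - F (z + d' h) - (F (z + e' h) - F z) =
      dpartial e' (dpartial d' F) (z + d' s + e' t) * h * h].
  move=> dl' el' B dF' edF' h0 hr.
  have Q (s : R) : 0 <= s <= h -> is_derive 0 (1 : R)
     (fun t => F (z + d' s + d' t + e' h) - F (z + d' s + d' t))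
     (dpartial d' F (z + d' s + e' h) - dpartial d' F (z + d' s)).
    move=> /andP[s0 sh]; apply: is_deriveB.
      have := dpartialP d' U F (z + d' s + e' h) dF'.
      under eq_fun do rewrite addrAC.
      by apply; apply: B; rewrite ger0_norm// ?(le_lt_trans sh)// ltW.
    apply: dpartialP dF' _.
    rewrite -[z + d' s]addr0 -(line0 _ el'); apply: B.
      by rewrite ger0_norm// (le_lt_trans sh).
    by rewrite normr0 (lt_trans h0).
  have [|s /andP[s0 sh] E] := line_MVT d' (fun w => F (w + e' h) - F w) z h dl' h0.
    by move=> s /Q[].
  have Es : dpartial d' (fun w => F (w + e' h) - F w) (z + d' s) =
     dpartial d' F (z + d' s + e' h) - dpartial d' F (z + d' s).
    by apply: dpartial_val; apply: Q; rewrite !ltW.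
  have [|t th E2] := line_MVT e' (dpartial d' F) (z + d' s) h el' h0.
    move=> t /andP[t0 th]; apply: edF'; apply: B; rewrite ger0_norm // ?(ltW s0)//.
      exact: lt_trans hr.
    exact: le_lt_trans hr.
  exists s, t; split=> [|//|]; first by rewrite s0.
  by rewrite -E2 -Es -E.
apply/eqP; rewrite -subr_eq0 -normr_le0; apply/ler_addgt0Pr => eps eps0.
have e20 : 0 < eps / 2 by rewrite divr_gt0.
have [V [oV Vz] HV] : exists2 V : set C, open V /\ V z & forall w, V w -> 
    `|dpartial d (dpartial e F) z - dpartial d (dpartial e F) w| < eps / 2 /\
    `|dpartial e (dpartial d F) z - dpartial e (dpartial d F) w| < eps / 2.
  move/cvgrPdist_lt: cde => /(_ _ e20) N1.
  move/cvgrPdist_lt: ced => /(_ _ e20) N2.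
  have [V [oV Vz] HV] : exists2 V : set C, open V /\ V z & V `<=`
      (fun w => `|dpartial d (dpartial e F) z - dpartial d (dpartial e F) w| < eps / 2) `&`
      (fun w => `|dpartial e (dpartial d F) z - dpartial e (dpartial d F) w| < eps / 2).
    have := @filterI _ (nbhs z) (nbhs_filter z) _ _ N1 N2.
    by rewrite nbhsE => -[V oV HV]; exists V.
  by exists V => // w /HV.
have [r r0 B] := near_box d e (U `&` V) z dl el (openI oU oV) (conj Uz Vz).
have B' s t : `|s| < r -> `|t| < r -> (U `&` V) (z + e s + d t).
  by move=> sr tr; rewrite addrAC; apply: B.
have h0 : 0 < r / 2 by rewrite divr_gt0.
have hr : r / 2 < r by rewrite ltr_pdivrMr// mulr_natr mulr2n ltrDl.
have [s [t [/andP[s0 sh] /andP[t0 th] E1]]] :=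
  key d e r (r / 2) dl el (fun s t hs ht => (B s t hs ht).1) dF edF h0 hr.
have [s' [t' [/andP[s0' sh'] /andP[t0' th'] E2]]] :=
  key e d r (r / 2) el dl (fun s t hs ht => (B' s t hs ht).1) eF deF h0 hr.
have hn x : 0 < x -> x < r / 2 -> `|x| < r.
  by move=> x0 xr; rewrite gtr0_norm// (lt_trans xr).
have [_ D1] := HV _ (B s t (hn _ s0 sh) (hn _ t0 th)).2.
have [D2 _] := HV _ (B' s' t' (hn _ s0' sh') (hn _ t0' th')).2.
(* Both instances of [key] evaluate the same second difference, which is symmetric in the two
   directions; the two factors r / 2 cancel. *)
have EE : dpartial e (dpartial d F) (z + d s + e t) =
          dpartial d (dpartial e F) (z + e s' + d t').
  apply: (mulIf (lt0r_neq0 h0)); apply: (mulIf (lt0r_neq0 h0)).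
  rewrite (addrAC z (e _) (d _)) in E2.
  exact: etrans (esym E1) (etrans (second_difference _ _ _ _) E2).
rewrite add0r; apply: le_trans (ler_distD (dpartial e (dpartial d F) (z + d s + e t)) _ _) _.
rewrite [leRHS]splitr; apply: lerD; last by rewrite distrC; exact: ltW D1.
by rewrite EE; exact: ltW D2.
Qed.

(** No Taylor expansion is involved: if the second derivative were positive, the first one, which
    vanishes at the maximum, would be positive just after it, and the mean value theorem would
    produce a value larger than [F z]. *)
Lemma max_dpartial2_le0 d U F z : is_line d -> open U -> U z ->
  line_derivable d U F -> line_derivable d U (dpartial d F) ->
  (forall w, U w -> F w <= F z) -> dpartial d (dpartial d F) z <= 0.
Proof.
move=> dl oU Uz dF ddF Fmax.
have /nbhs_ballP[r /= r0 B] := near_line d U z dl oU Uz.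
have D s : `|s| < r -> is_derive s (1 : R) (fun t => F (z + d t)) (dpartial d F (z + d s)).
  move=> sr; apply: is_derive_line_shift => //; apply: dpartialP dF _.
  by apply: B; rewrite /ball/= sub0r normrN.
have F1 : dpartial d F z = 0.
  have sub t : t \in `](- r), r[ -> `|t| < r by rewrite in_itv/= ltr_norml.
  have : is_derive (0 : R) (1 : R) (fun t => F (z + d t)) 0.
    apply: (@derive1_at_max R _ (- r) r).
    - by rewrite (@le_trans _ _ 0)// ?oppr_le0 ltW.
    - by move=> t /sub /D[].
    - by rewrite in_itv/= oppr_lt0 r0.
    move=> t /sub tr; rewrite line0// addr0; apply: Fmax; apply: B.
    by rewrite /ball/= sub0r normrN.
  move=> [_ D0]; have [|_] := D 0; first by rewrite normr0.
  by rewrite D0 (line0 _ dl) addr0.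
rewrite leNgt; apply/negP => H.
(* As [dpartial d F z = 0], this is the difference quotient of the first derivative, whose limit is
   positive by [H]. *)
have : \forall h \near (0:R)^', 0 < h^-1 * dpartial d F (z + d h).
  have [/cvg_ex[l cl] v] := dpartialP d U _ z ddF Uz.
  have ll : 'D_1 (fun t => dpartial d F (z + d t)) 0 = l by apply: cvg_lim cl.
  have l0 : 0 < l by rewrite -ll v.
  move/cvgr_gt: cl => /(_ 0 l0); apply: filterS => h /=.
  by rewrite (line0 _ dl) !addr0 F1 subr0 -[h *: 1]/(h * 1) mulr1.
move=> /nbhs_ballP[r' /= r'0 B'].
have [h [h0 hr hr']] : exists h : R, [/\ 0 < h, h < r & h < r'].
  exists (Num.min r r' / 2); apply/and3P.
  by rewrite divr_gt0 ?lt_min ?r0// !ltr_pdivrMr// !gt_min !mulr_natr !mulr2n !ltrDl r0 r'0 orbT.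
have [|s /andP[s0 sh] E] := line_MVT d F z h dl h0.
  move=> s /andP[s0 sh]; apply: dF; apply: B.
  by rewrite /ball/= sub0r normrN ger0_norm// (le_lt_trans sh).
have : F (z + d h) - F z <= 0.
  rewrite subr_le0; apply: Fmax; apply: B.
  by rewrite /ball/= sub0r normrN gtr0_norm.
rewrite E leNgt pmulr_lgt0//.
have := B' s; rewrite /ball/= sub0r normrN gtr0_norm// => /(_ (lt_trans sh hr')) /(_ (lt0r_neq0 s0)).
by rewrite pmulr_rgt0 ?invr_gt0// => ->.
Qed.

End SecondOrder.

(** * Closure properties of smooth functions *)

Section ContDiff.
Context {R : realType}.
Local Notation C := (plane R).
Implicit Types (d : R -> C) (F G : C -> R) (U : set C) (z : C) (n : nat).

(** The derivative is carried as an explicit function on all of [U], so that it can be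
    differentiated again and second derivatives are computed by composing rules. *)
Definition has_partial d U F (dF : C -> R) : Prop :=
  forall z, U z -> is_derive (0 : R) (1 : R) (fun t => F (z + d t)) (dF z).

Lemma has_partial_derivable d U F dF :
  has_partial d U F dF -> line_derivable d U F.
Proof. by move=> H z /H[]. Qed.

Lemma has_partial_val d U F dF z :
  has_partial d U F dF -> U z -> dpartial d F z = dF z.
Proof. by move=> H /H; exact: dpartial_val. Qed.

Lemma has_partial_eq d U F G dF : is_line d -> open U ->
  (forall w, U w -> F w = G w) -> has_partial d U F dF -> has_partial d U G dF.
Proof. by move=> dl oU FG H z Uz; apply: (is_derive_line_eq d F G U) => //; exact: H. Qed.

Lemma has_partial_cst d U (c : R) : has_partial d U (fun=> c) (fun=> 0).
Proof. by move=> z _; exact: is_derive_cst. Qed.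

Lemma has_partialD d U F G dF dG : has_partial d U F dF ->
  has_partial d U G dG ->
  has_partial d U (fun w => F w + G w) (fun w => dF w + dG w).
Proof. by move=> HF HG z Uz; apply: is_deriveD; [exact: HF|exact: HG]. Qed.

Lemma has_partialM d U F G dF dG : is_line d -> has_partial d U F dF ->
  has_partial d U G dG ->
  has_partial d U (fun w => F w * G w) (fun w => F w * dG w + G w * dF w).
Proof.
move=> dl HF HG z Uz.
by have := is_deriveM (HF z Uz) (HG z Uz); rewrite line0// addr0.
Qed.

(** The derivative is kept as a product of [(F w)^-1] and [dF w], a shape to which the product and
    inverse rules apply again. *)
Lemma has_partialV d U F dF : is_line d -> (forall w, U w -> F w != 0) ->
  has_partial d U F dF ->
  has_partial d U (fun w => (F w)^-1) (fun w => - (F w)^-1 * (F w)^-1 * dF w).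
Proof.
move=> dl F0 HF z Uz.
have := @is_deriveV R (fun t => F (z + d t)) 0 (dF z) 1.
rewrite line0// addr0 => /(_ (F0 z Uz) (HF z Uz)).
by rewrite expr2 invfM mulNr.
Qed.

Lemma has_partial_ln d U F dF : is_line d -> (forall w, U w -> 0 < F w) ->
  has_partial d U F dF ->
  has_partial d U (fun w => ln (F w)) (fun w => (F w)^-1 * dF w).
Proof.
move=> dl F0 HF z Uz.
apply: (@is_derive1_comp R (@ln R) (fun t => F (z + d t)) 0); last exact: HF.
by rewrite line0// addr0; apply: is_derive1_ln; exact: F0.
Qed.

Lemma cont_diff_on_continuous n U F z :
  cont_diff_on n U F -> U z -> {for z, continuous F}.
Proof. by case: n => [|n] [H _] /H. Qed.

Lemma cont_diff_on_partial_x n U F :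
  cont_diff_on n.+1 U F -> has_partial line_x U F (partial_x F).
Proof. by move=> [_ [H _ _ _]] z Uz; exact: dpartialP H Uz. Qed.

Lemma cont_diff_on_partial_y n U F :
  cont_diff_on n.+1 U F -> has_partial line_y U F (partial_y F).
Proof. by move=> [_ [_ H _ _]] z Uz; exact: dpartialP H Uz. Qed.

Lemma continuous_for_eq U F G z : open U -> U z ->
  (forall w, U w -> F w = G w) ->
  {for z, continuous F} -> {for z, continuous G}.
Proof.
move=> oU Uz FG; rewrite /prop_for/continuous_at -FG//; apply: cvg_trans.
have zU : nbhs z U by exact: open_nbhs_nbhs.
have := @near_eq_cvg _ _ (nbhs z) _ F G.
by apply; apply: filterS zU => w /FG.
Qed.

Lemma cont_diff_on_x n U F : cont_diff_on n.+1 U F -> cont_diff_on n U (partial_x F).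
Proof. by case=> _ []. Qed.

Lemma cont_diff_on_y n U F : cont_diff_on n.+1 U F -> cont_diff_on n U (partial_y F).
Proof. by case=> _ []. Qed.

Lemma cont_diff_on_eq n U F G : open U -> (forall w, U w -> F w = G w) ->
  cont_diff_on n U F -> cont_diff_on n U G.
Proof.
move=> oU; elim: n F G => [|n IH] F G FG /= [cF dF]; split => //.
- by move=> z Uz; apply: continuous_for_eq FG (cF z Uz).
- by move=> z Uz; apply: continuous_for_eq FG (cF z Uz).
- case: dF => dx dy cx cy; split.
  + by apply: line_derivable_eq FG dx => //; exact: is_line_x.
  + by apply: line_derivable_eq FG dy => //; exact: is_line_y.
  + apply: IH cx => w Uw; apply: (dpartial_eq line_x F G U) => //; exact: is_line_x.
  + apply: IH cy => w Uw; apply: (dpartial_eq line_y F G U) => //; exact: is_line_y.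
Qed.

Lemma cont_diff_onSI n U F Fx Fy : open U ->
  (forall z, U z -> {for z, continuous F}) ->
  has_partial line_x U F Fx -> has_partial line_y U F Fy ->
  cont_diff_on n U Fx -> cont_diff_on n U Fy -> cont_diff_on n.+1 U F.
Proof.
move=> oU cF dx dy cx cy; split => //; split.
- exact: has_partial_derivable dx.
- exact: has_partial_derivable dy.
- by apply: cont_diff_on_eq cx => // w Uw; rewrite -(has_partial_val _ _ _ _ _ dx Uw).
- by apply: cont_diff_on_eq cy => // w Uw; rewrite -(has_partial_val _ _ _ _ _ dy Uw).
Qed.

(** Partials of products and inverses still contain the undifferentiated factors, which must be
    lowered by one class before the induction hypothesis applies. *)
Lemma cont_diff_onW n U F : cont_diff_on n.+1 U F -> cont_diff_on n U F.
Proof.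
elim: n F => [|n IH] F [cF [dx dy cx cy]]; split.
- exact: cF.
- exact: I.
- exact: cF.
- by split; [exact dx|exact dy|exact (IH _ cx)|exact (IH _ cy)].
Qed.

Lemma cont_diff_on_cst n U (c : R) : open U -> cont_diff_on n U (fun=> c).
Proof.
move=> oU; elim: n c => [|n IH] c.
  by split; [move=> z _; exact: cst_continuous|exact: I].
apply: (cont_diff_onSI _ _ _ (fun=> 0) (fun=> 0) oU).
- by move=> z _; exact: cst_continuous.
- exact: has_partial_cst.
- exact: has_partial_cst.
- exact: IH.
- exact: IH.
Qed.

Lemma cont_diff_onD n U F G : open U -> cont_diff_on n U F ->
  cont_diff_on n U G -> cont_diff_on n U (fun w => F w + G w).
Proof.
move=> oU; elim: n F G => [|n IH] F G HF HG.
  by split; last exact: I; move=> z Uz; exact: cvgD (HF.1 z Uz) (HG.1 z Uz).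
apply: (cont_diff_onSI _ _ _ _ _ oU).
- by move=> z Uz; exact: cvgD (HF.1 z Uz) (HG.1 z Uz).
- by apply: has_partialD; apply: cont_diff_on_partial_x; [exact: HF|exact: HG].
- by apply: has_partialD; apply: cont_diff_on_partial_y; [exact: HF|exact: HG].
- exact: IH (cont_diff_on_x _ _ _ HF) (cont_diff_on_x _ _ _ HG).
- exact: IH (cont_diff_on_y _ _ _ HF) (cont_diff_on_y _ _ _ HG).
Qed.

Lemma cont_diff_onM n U F G : open U -> cont_diff_on n U F ->
  cont_diff_on n U G -> cont_diff_on n U (fun w => F w * G w).
Proof.
move=> oU; elim: n F G => [|n IH] F G HF HG.
  by split; last exact: I; move=> z Uz; exact: cvgM (HF.1 z Uz) (HG.1 z Uz).
apply: (cont_diff_onSI _ _ _ _ _ oU).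
- by move=> z Uz; exact: cvgM (HF.1 z Uz) (HG.1 z Uz).
- apply: has_partialM; first exact: is_line_x.
    exact: cont_diff_on_partial_x HF.
  exact: cont_diff_on_partial_x HG.
- apply: has_partialM; first exact: is_line_y.
    exact: cont_diff_on_partial_y HF.
  exact: cont_diff_on_partial_y HG.
- apply: cont_diff_onD oU _ _.
    exact: IH (cont_diff_onW _ _ _ HF) (cont_diff_on_x _ _ _ HG).
  exact: IH (cont_diff_onW _ _ _ HG) (cont_diff_on_x _ _ _ HF).
- apply: cont_diff_onD oU _ _.
    exact: IH (cont_diff_onW _ _ _ HF) (cont_diff_on_y _ _ _ HG).
  exact: IH (cont_diff_onW _ _ _ HG) (cont_diff_on_y _ _ _ HF).
Qed.

Lemma cont_diff_onV n U F : open U -> (forall w, U w -> F w != 0) ->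
  cont_diff_on n U F -> cont_diff_on n U (fun w => (F w)^-1).
Proof.
move=> oU F0; elim: n => [|n IH] HF.
  by split; last exact: I; move=> z Uz; exact: cvgV (F0 z Uz) (HF.1 z Uz).
(* This is the factor of [dF] in the derivative of the inverse; it has class [n] by induction. *)
have IF : cont_diff_on n U (fun w => - (F w)^-1 * (F w)^-1).
  apply: (cont_diff_on_eq _ _ (fun w => -1 * ((F w)^-1 * (F w)^-1))) => //.
    by move=> w _; rewrite mulN1r mulNr.
  apply: cont_diff_onM => //; first exact: cont_diff_on_cst.
  by apply: cont_diff_onM => //; apply: IH; exact: cont_diff_onW.
apply: (cont_diff_onSI _ _ _ _ _ oU).
- by move=> z Uz; exact: cvgV (F0 z Uz) (HF.1 z Uz).
- apply: has_partialV => //; first exact: is_line_x.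
  exact: cont_diff_on_partial_x HF.
- apply: has_partialV => //; first exact: is_line_y.
  exact: cont_diff_on_partial_y HF.
- exact: cont_diff_onM oU IF (cont_diff_on_x _ _ _ HF).
- exact: cont_diff_onM oU IF (cont_diff_on_y _ _ _ HF).
Qed.

Lemma plane_laplacian_eq U F G z : open U -> U z ->
  (forall w, U w -> F w = G w) -> plane_laplacian F z = plane_laplacian G z.
Proof.
move=> oU Uz FG.
have E d : is_line d -> dpartial d (dpartial d F) z = dpartial d (dpartial d G) z.
  move=> dl; apply: (dpartial_eq _ _ _ _ _ dl oU Uz) => w Uw.
  exact: dpartial_eq dl oU Uw FG.
exact: (f_equal2 +%R (E _ is_line_x) (E _ is_line_y)).
Qed.

Lemma plane_laplacian_val U F Fx Fy Fxx Fyy z : open U -> U z ->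
  has_partial line_x U F Fx -> has_partial line_y U F Fy ->
  has_partial line_x U Fx Fxx -> has_partial line_y U Fy Fyy ->
  plane_laplacian F z = Fxx z + Fyy z.
Proof.
move=> oU Uz dx dy dxx dyy.
have E d Fd Fdd : is_line d -> has_partial d U F Fd -> has_partial d U Fd Fdd ->
    dpartial d (dpartial d F) z = Fdd z.
  move=> dl H HH; rewrite -(has_partial_val _ _ _ _ _ HH Uz).
  by apply: (dpartial_eq _ _ _ _ _ dl oU Uz) => w; exact: has_partial_val H.
exact: (f_equal2 +%R (E _ _ _ is_line_x dx dxx) (E _ _ _ is_line_y dy dyy)).
Qed.

Lemma plane_laplacianD U F G z : open U -> U z ->
  cont_diff_on 2 U F -> cont_diff_on 2 U G ->
  plane_laplacian (fun w => F w + G w) z =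
  plane_laplacian F z + plane_laplacian G z.
Proof.
move=> oU Uz HF HG.
have Fx := cont_diff_on_x _ _ _ HF; have Fy := cont_diff_on_y _ _ _ HF.
have Gx := cont_diff_on_x _ _ _ HG; have Gy := cont_diff_on_y _ _ _ HG.
rewrite (plane_laplacian_val U _ _ _ _ _ _ oU Uz
  (has_partialD _ _ _ _ _ _ (cont_diff_on_partial_x _ _ _ HF) (cont_diff_on_partial_x _ _ _ HG))
  (has_partialD _ _ _ _ _ _ (cont_diff_on_partial_y _ _ _ HF) (cont_diff_on_partial_y _ _ _ HG))
  (has_partialD _ _ _ _ _ _ (cont_diff_on_partial_x _ _ _ Fx) (cont_diff_on_partial_x _ _ _ Gx))
  (has_partialD _ _ _ _ _ _ (cont_diff_on_partial_y _ _ _ Fy) (cont_diff_on_partial_y _ _ _ Gy))).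
exact: addrACA.
Qed.

Lemma plane_laplacianZ U (c : R) F z : open U -> U z -> cont_diff_on 2 U F ->
  plane_laplacian (fun w => c * F w) z = c * plane_laplacian F z.
Proof.
move=> oU Uz HF; have Fx := cont_diff_on_x _ _ _ HF; have Fy := cont_diff_on_y _ _ _ HF.
have Z d G dG : is_line d -> has_partial d U G dG ->
    has_partial d U (fun w => c * G w) (fun w => c * dG w).
  move=> dl HG w Uw.
  have := has_partialM d U _ _ _ _ dl (has_partial_cst d U c) HG w Uw.
  by rewrite mulr0 addr0.
rewrite (plane_laplacian_val U _ _ _ _ _ _ oU Uz
  (Z _ _ _ is_line_x (cont_diff_on_partial_x _ _ _ HF))
  (Z _ _ _ is_line_y (cont_diff_on_partial_y _ _ _ HF))
  (Z _ _ _ is_line_x (cont_diff_on_partial_x _ _ _ Fx))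
  (Z _ _ _ is_line_y (cont_diff_on_partial_y _ _ _ Fy))).
by rewrite mulrDr.
Qed.

End ContDiff.

(** * Cauchy-Riemann equations *)

Section CauchyRiemann.
Context {R : realType}.
Local Notation C := (plane R).
Implicit Types (d : R -> C) (f : C -> C) (U : set C) (z : C).

Lemma normc_Re_le (w : C) : `|complex.Re w| <= ComplexField.Normc.normc w.
Proof.
case: w => x y /=; rewrite -sqrtr_sqr ler_wsqrtr// lerDl; exact: sqr_ge0.
Qed.

Lemma normc_Im_le (w : C) : `|complex.Im w| <= ComplexField.Normc.normc w.
Proof.
case: w => x y /=; rewrite -sqrtr_sqr ler_wsqrtr// lerDr; exact: sqr_ge0.
Qed.

Lemma continuous_of_normc_le (p : C -> R) :
  (forall v w, p (v - w) = p v - p w) ->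
  (forall w, `|p w| <= ComplexField.Normc.normc w) -> continuous p.
Proof.
move=> pB ple w; have Fw := nbhs_filter w.
apply/(@cvgrPdist_lt _ _ _ (nbhs w)) => e e0.
have e0' : 0 < Complex e 0 by rewrite ltcE/= eqxx.
have /cvgrPdist_lt/(_ _ e0') : (fun v : C => v) @ w --> w by exact: cvg_id.
apply: filterS => v /=; rewrite norm_normc ltcE/= => /andP[_]; apply: le_lt_trans.
by rewrite -pB.
Qed.

Lemma continuous_Re : continuous (fun w : C => complex.Re w).
Proof.
apply: continuous_of_normc_le normc_Re_le; by case=> [? ?] [? ?].
Qed.

Lemma continuous_Im : continuous (fun w : C => complex.Im w).
Proof.
apply: continuous_of_normc_le normc_Im_le; by case=> [? ?] [? ?].
Qed.

(** A complex limit may be restricted to the line t e, and (t e)^-1 e = t^-1 turns the complex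
    quotient into the real one. The real-linear [p] will be Re or Im. *)
Lemma is_derive_along_line d (e : C) (p : C -> R) f z : is_line d -> e != 0 ->
  (forall t, d t = Complex t 0 * e) -> continuous p ->
  (forall v w, p (v - w) = p v - p w) ->
  (forall (t : R) w, p (Complex t 0 * w) = t * p w) ->
  derivable f z 1 ->
  is_derive (0 : R) (1 : R) (fun t => p (f (z + d t))) (p (e * 'D_1 f z)).
Proof.
move=> dl e0 dE cp pB pM df.
(* Since [e != 0], the line avoids 0 for t nonzero, so the limit over the punctured plane can be
   pulled back. *)
have d0 : d @ (0 : R)^' --> (0 : C)^'.
  move=> A [r r0 B].
  have : d @ (0 : R) --> (0 : C) by rewrite -(line0 d dl); exact: dl.2.
  move=> /(_ (ball (0 : C) r) (nbhsx_ballx _ _ r0)) [s s0 B'].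
  exists s => // t ts t0; apply: B; first exact: B'.
  rewrite dE mulf_neq0//; apply: contraNneq t0 => /eqP.
  by rewrite eq_complex/= => /andP[].
have q := cvg_comp _ _ d0 df.
have q2 : (fun t => p (e * ((d t)^-1 *: ((f \o shift z) (d t *: 1) - f z)))) @ (0 : R)^' --> p (e * 'D_1 f z).
  have Fz : Filter (0 : R)^' by exact: dnbhs_filter.
  have q1 := @cvgM _ _ _ Fz (fun=> e) _ e _ (cvg_cst e) q.
  exact: cvg_comp _ _ (q1 Fz) (cp _).
have q3 : (fun h : R => h^-1 *: (((fun t => p (f (z + d t))) \o shift 0) (h *: 1)
    - p (f (z + d 0)))) @ (0 : R)^' --> p (e * 'D_1 f z).
  apply: cvg_trans q2; apply: near_eq_cvg.
  apply: filterS (nbhs_dnbhs_neq (0 : R)) => t t0 /=.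
  rewrite !addr0 line0// addr0 -pB -[_ *: _ in RHS]/(_ * _) -[t *: 1]/(t * 1) mulr1.
  rewrite -[d t *: 1]/(d t * 1) mulr1 [d t + z]addrC.
  rewrite -pM; congr p; rewrite dE.
  have -> : Complex t^-1 0 = (Complex t 0)^-1 by exact: (fmorphV (real_complex R)).
  by rewrite -[_ *: _]/(_ * _) mulrA invfM mulrCA mulfV// mulr1.
apply: DeriveDef; first by apply/cvg_ex; exists (p (e * 'D_1 f z)).
exact: cvg_lim q3.
Qed.


(** In the directions 1 and i the derivatives are f' and i f'; it remains to compare their real and
    imaginary parts. *)
Lemma cauchy_riemann f z : derivable f z 1 ->
  partial_y (fun w => complex.Re (f w)) z = - partial_x (fun w => complex.Im (f w)) z /\
  partial_y (fun w => complex.Im (f w)) z = partial_x (fun w => complex.Re (f w)) z.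
Proof.
move=> df.
have lx (t : R) : line_x t = Complex t 0 * 1 by rewrite mulr1.
have ly (t : R) : line_y t = Complex t 0 * Complex 0 1.
  by apply/eqP; rewrite eq_complex/= !mul0r !mulr0 mulr1 subrr addr0 !eqxx.
have i0 : Complex 0 1 != 0 :> C by rewrite eq_complex/= oner_eq0 andbF.
have ReM (t : R) (w : C) : complex.Re (Complex t 0 * w) = t * complex.Re w.
  by case: w => a b /=; rewrite mul0r subr0.
have ImM (t : R) (w : C) : complex.Im (Complex t 0 * w) = t * complex.Im w.
  by case: w => a b /=; rewrite mul0r addr0.
have ReB (v w : C) : complex.Re (v - w) = complex.Re v - complex.Re w by case: v w => [? ?] [? ?].
have ImB (v w : C) : complex.Im (v - w) = complex.Im v - complex.Im w by case: v w => [? ?] [? ?].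
have Rx := is_derive_along_line _ _ _ f z is_line_x (oner_neq0 _) lx continuous_Re ReB ReM df.
have Ix := is_derive_along_line _ _ _ f z is_line_x (oner_neq0 _) lx continuous_Im ImB ImM df.
have Ry := is_derive_along_line _ _ _ f z is_line_y i0 ly continuous_Re ReB ReM df.
have Iy := is_derive_along_line _ _ _ f z is_line_y i0 ly continuous_Im ImB ImM df.
have E1 := dpartial_val line_x (fun w => complex.Re (f w)) z _ Rx.
have E2 := dpartial_val line_x (fun w => complex.Im (f w)) z _ Ix.
have E3 := dpartial_val line_y (fun w => complex.Re (f w)) z _ Ry.
have E4 := dpartial_val line_y (fun w => complex.Im (f w)) z _ Iy.
split.
  apply: (etrans E3); apply: (etrans _ (f_equal -%R (esym E2))).
  by rewrite mul1r; case: ('D_1 f z) => a b /=; rewrite mul0r mul1r sub0r.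
apply: (etrans E4); apply: (etrans _ (esym E1)).
by rewrite mul1r; case: ('D_1 f z) => a b /=; rewrite mul0r mul1r add0r.
Qed.

(* By the Cauchy-Riemann equations the Laplacian of Re f is the difference of
   the mixed partials of Im f, and conversely. *)
Lemma holomorphic_harmonic U f z : open U -> U z -> holomorphic_on U f ->
  plane_laplacian (fun w => complex.Re (f w)) z = 0 /\
  plane_laplacian (fun w => complex.Im (f w)) z = 0.
Proof.
move=> oU Uz [sa sb hf].
set a := fun w => complex.Re (f w); set b := fun w => complex.Im (f w).
have mixed (F : C -> R) : smooth_on U F ->
    dpartial line_y (dpartial line_x F) z = dpartial line_x (dpartial line_y F) z.
  move=> sF.
  have Fx := cont_diff_on_x _ _ _ (sF 2); have Fy := cont_diff_on_y _ _ _ (sF 2).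
  apply: (dpartialC line_y line_x U) => //.
  - exact: is_line_y.
  - exact: is_line_x.
  - exact: has_partial_derivable (cont_diff_on_partial_y _ _ _ (sF 1)).
  - exact: has_partial_derivable (cont_diff_on_partial_x _ _ _ (sF 1)).
  - exact: has_partial_derivable (cont_diff_on_partial_y _ _ _ Fx).
  - exact: has_partial_derivable (cont_diff_on_partial_x _ _ _ Fy).
  - exact: cont_diff_on_continuous (cont_diff_on_y _ _ _ Fx) Uz.
  - exact: cont_diff_on_continuous (cont_diff_on_x _ _ _ Fy) Uz.
have CR w (Uw : U w) := cauchy_riemann f w (hf w Uw).
have ax := cont_diff_on_x _ _ _ (sa 2); have ay := cont_diff_on_y _ _ _ (sa 2).
have bx := cont_diff_on_x _ _ _ (sb 2); have b_y := cont_diff_on_y _ _ _ (sb 2).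
have opp d F dF : has_partial d U F dF -> has_partial d U (fun w => - F w) (fun w => - dF w).
  by move=> H w Uw; apply: is_deriveN; exact: H.
(* The Cauchy-Riemann equations hold on all of [U], so first partials can be exchanged before the
   second differentiation. *)
have axx : has_partial line_x U (partial_x a) (partial_x (partial_y b)).
  apply: (has_partial_eq _ _ _ _ _ is_line_x oU _ (cont_diff_on_partial_x _ _ _ b_y)).
  by move=> w /CR[_].
have ayy : has_partial line_y U (partial_y a) (fun w => - partial_y (partial_x b) w).
  apply: (has_partial_eq _ _ _ _ _ is_line_y oU _ (opp _ _ _ (cont_diff_on_partial_y _ _ _ bx))).
  by move=> w /CR[->].
have bxx : has_partial line_x U (partial_x b) (fun w => - partial_x (partial_y a) w).
  apply: (has_partial_eq _ _ _ _ _ is_line_x oU _ (opp _ _ _ (cont_diff_on_partial_x _ _ _ ay))).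
  by move=> w /CR[-> _]; exact: opprK.
have byy : has_partial line_y U (partial_y b) (partial_y (partial_x a)).
  apply: (has_partial_eq _ _ _ _ _ is_line_y oU _ (cont_diff_on_partial_y _ _ _ ax)).
  by move=> w /CR[_].
split.
  rewrite (plane_laplacian_val U _ _ _ _ _ _ oU Uz (cont_diff_on_partial_x _ _ _ (sa 1))
    (cont_diff_on_partial_y _ _ _ (sa 1)) axx ayy).
  apply/eqP; rewrite subr_eq0; apply/eqP; exact: esym (mixed b sb).
rewrite (plane_laplacian_val U _ _ _ _ _ _ oU Uz (cont_diff_on_partial_x _ _ _ (sb 1))
  (cont_diff_on_partial_y _ _ _ (sb 1)) bxx byy).
rewrite addrC; apply/eqP; rewrite subr_eq0; apply/eqP; exact: mixed a sa.
Qed.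

End CauchyRiemann.

(** * The pointwise norm in a conformal coordinate *)

Section ConformalNorm.
Context {R : realType}.
Local Notation C := (plane R).
Implicit Types (d : R -> C) (U : set C) (z : C).

Lemma has_partial_ext d U F dF dG : (forall w, U w -> dF w = dG w) ->
  has_partial (R := R) d U F dF -> has_partial d U F dG.
Proof. by move=> E H w Uw; rewrite -E//; exact: H. Qed.

(** Here [i] stands for 1/g, entering through its derivative - i^2 g'. Everything is expressed by
    the logarithmic derivative i g' and by i g'', the quantities that the curvature equation
    relates. *)
Lemma has_partial_norm2 d U (a b i a' b' g' a'' b'' g'' : C -> R) : is_line d ->
  has_partial d U a a' -> has_partial d U b b' ->
  has_partial d U i (fun w => - i w * i w * g' w) ->
  has_partial d U a' a'' -> has_partial d U b' b'' -> has_partial d U g' g'' ->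
  let V' w := (i w * i w) * (2 * (a w * a' w + b w * b' w)
    - 2 * (a w * a w + b w * b w) * (i w * g' w)) in
  has_partial d U (fun w => (a w * a w + b w * b w) * (i w * i w)) V' /\
  has_partial d U V' (fun w => (i w * i w) *
    (2 * (a' w ^+ 2 + b' w ^+ 2 + a w * a'' w + b w * b'' w)
     - 8 * (a w * a' w + b w * b' w) * (i w * g' w)
     + (a w ^+ 2 + b w ^+ 2) * (6 * (i w * g' w) ^+ 2 - 2 * (i w * g'' w)))).
Proof.
move=> dl Ha Hb Hi Ha' Hb' Hg' V'.
have M F G F' G' := @has_partialM R d U F G F' G' dl.
have HN := has_partialD _ _ _ _ _ _ (M _ _ _ _ Ha Ha) (M _ _ _ _ Hb Hb).
have Hii := M _ _ _ _ Hi Hi.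
split.
  apply: has_partial_ext (M _ _ _ _ HN Hii) => w Uw; rewrite /V'; ring.
have c2 := has_partial_cst d U (2 : R); have c2' := has_partial_cst d U (- 2 : R).
have Hab := has_partialD _ _ _ _ _ _ (M _ _ _ _ Ha Ha') (M _ _ _ _ Hb Hb').
have Hig := M _ _ _ _ Hi Hg'.
have := M _ _ _ _ Hii (has_partialD _ _ _ _ _ _ (M _ _ _ _ c2 Hab)
  (M _ _ _ _ (M _ _ _ _ c2' HN) Hig)).
have -> : (fun w => i w * i w * (2 * (a w * a' w + b w * b' w) +
   - 2 * (a w * a w + b w * b w) * (i w * g' w))) = V'.
  by apply/funext => w; rewrite /V' !mulNr.
by apply: has_partial_ext => w Uw; ring.
Qed.

(** The equation lap (ln g) = 2 g, expanded and solved for the second derivatives of g, so that they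
    can be eliminated from the Laplacian of the norm. *)
Lemma laplacian_ln_curvature U (g : C -> R) z : open U -> U z -> cont_diff_on 2 U g ->
  (forall w, U w -> 0 < g w) -> gauss_curvature g z = -1 ->
  let i := (g z)^-1 in
  i * partial_x (partial_x g) z + i * partial_y (partial_y g) z =
  2 * g z + (i * partial_x g z) ^+ 2 + (i * partial_y g z) ^+ 2.
Proof.
move=> oU Uz sg g0.
have gn0 w (Uw : U w) : g w != 0 by rewrite gt_eqF// g0.
have gx := cont_diff_on_partial_x _ _ _ sg; have gy := cont_diff_on_partial_y _ _ _ sg.
have gxx := cont_diff_on_partial_x _ _ _ (cont_diff_on_x _ _ _ sg).
have gyy := cont_diff_on_partial_y _ _ _ (cont_diff_on_y _ _ _ sg).
rewrite /gauss_curvature (plane_laplacian_val U _ _ _ _ _ _ oU Uz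
 (has_partial_ln _ _ _ _ is_line_x g0 gx) (has_partial_ln _ _ _ _ is_line_y g0 gy)
 (has_partialM _ _ _ _ _ _ is_line_x (has_partialV _ _ _ _ is_line_x gn0 gx) gxx)
 (has_partialM _ _ _ _ _ _ is_line_y (has_partialV _ _ _ _ is_line_y gn0 gy) gyy)).
move: (partial_x g z) (partial_y g z) (partial_x (partial_x g) z) (partial_y (partial_y g) z) => p q pp qq.
have := gn0 z Uz; move: (g z) => t t0.
set L := (X in - X / _ = _) => K.
have {}K : L = 2 * t.
  have t2 : 2 * t != 0 by rewrite mulf_neq0.
  by rewrite -[LHS](divfK t2) -[L / _]opprK -mulNr K opprK mul1r.
by rewrite -K /L; ring.
Qed.

Lemma laplacian_conformal_norm_ge U (f : C -> C) (g : C -> R) z : open U -> U z ->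
  holomorphic_on U f -> cont_diff_on 2 U g -> (forall w, U w -> 0 < g w) ->
  gauss_curvature g z = -1 ->
  let V w := (complex.Re (f w) * complex.Re (f w) + complex.Im (f w) * complex.Im (f w)) *
             ((g w)^-1 * (g w)^-1) in
  - 4 * g z * V z <= plane_laplacian V z.
Proof.
move=> oU Uz hf sg g0 K; cbv zeta.
have gn0 w (Uw : U w) : g w != 0 by rewrite gt_eqF// g0.
have {K} /= := laplacian_ln_curvature _ _ _ oU Uz sg g0 K.
have gx := cont_diff_on_partial_x _ _ _ sg; have gy := cont_diff_on_partial_y _ _ _ sg.
have gxx := cont_diff_on_partial_x _ _ _ (cont_diff_on_x _ _ _ sg).
have gyy := cont_diff_on_partial_y _ _ _ (cont_diff_on_y _ _ _ sg).
have [Ha Hb] := holomorphic_harmonic _ _ _ oU Uz hf.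
have [sa sb df] := hf.
have [CR1 CR2] := cauchy_riemann _ _ (df z Uz).
move: Ha Hb CR1 CR2.
set a := fun w => complex.Re (f w); set b := fun w => complex.Im (f w).
move=> Ha Hb CR1 CR2 K.
have [Vx Vxx] := has_partial_norm2 _ _ _ _ _ _ _ _ _ _ _ is_line_x
  (cont_diff_on_partial_x _ _ _ (sa 2)) (cont_diff_on_partial_x _ _ _ (sb 2))
  (has_partialV _ _ _ _ is_line_x gn0 gx)
  (cont_diff_on_partial_x _ _ _ (cont_diff_on_x _ _ _ (sa 2)))
  (cont_diff_on_partial_x _ _ _ (cont_diff_on_x _ _ _ (sb 2))) gxx.
have [Vy Vyy] := has_partial_norm2 _ _ _ _ _ _ _ _ _ _ _ is_line_y
  (cont_diff_on_partial_y _ _ _ (sa 2)) (cont_diff_on_partial_y _ _ _ (sb 2))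
  (has_partialV _ _ _ _ is_line_y gn0 gy)
  (cont_diff_on_partial_y _ _ _ (cont_diff_on_y _ _ _ (sa 2)))
  (cont_diff_on_partial_y _ _ _ (cont_diff_on_y _ _ _ (sb 2))) gyy.
have -> := plane_laplacian_val _ _ _ _ _ _ _ oU Uz Vx Vy Vxx Vyy.
rewrite -/a -/b.
rewrite /plane_laplacian in Ha Hb.
rewrite CR1 CR2; clear CR1 CR2 Vx Vy Vxx Vyy.
move: Ha Hb K.
(* All values at [z] become independent real variables, the inverse of [g z] included; what remains
   is polynomial algebra. *)
move: (complex.Re (f z)) (complex.Im (f z)) (g z) ((g z)^-1)
 (partial_x a z) (partial_x b z) (partial_x g z) (partial_y g z)
 (partial_x (partial_x a) z) (partial_y (partial_y a) z)
 (partial_x (partial_x b) z) (partial_y (partial_y b) z)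
 (partial_x (partial_x g) z) (partial_y (partial_y g) z).
clear => a b g i p q gx gy axx ayy bxx byy gxx gyy Ha Hb K.
have {}Ha : axx = - ayy by apply/eqP; rewrite -addr_eq0 Ha.
have {}Hb : bxx = - byy by apply/eqP; rewrite -addr_eq0 Hb.
rewrite -subr_ge0.
set lhs := (X in 0 <= X).
(* With f' = p + q sqrt(-1), the first summand is the completed square; the second is a multiple of
   the curvature equation [K] and vanishes. *)
have -> : lhs = (2 * i) ^+ 2 * ((p - i * (a * gx + b * gy)) ^+ 2 + (q - i * (b * gx - a * gy)) ^+ 2)
  + (i * i) * (a ^+ 2 + b ^+ 2) * 2 * (2 * g + (i * gx) ^+ 2 + (i * gy) ^+ 2 - (i * gxx + i * gyy)).
  rewrite /lhs Ha Hb.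
  ring.
by rewrite K subrr mulr0 addr0 mulr_ge0 ?addr_ge0 ?sqr_ge0.
Qed.

End ConformalNorm.

(** * The maximum principle on the surface *)

Section Surface.
Context {R : realType} {S : topologicalType} (A : conformal_atlas R S).
Context (g0 : hyperbolic_metric A).
Implicit Types (f h : S -> R) (i : chart_index A) (p : S).

Lemma chart_image_chart i p : chart_dom i p -> chart_image i (chart i p).
Proof. by exists p. Qed.

Lemma chart_image_at p : chart_image (chart_at A p) (chart (chart_at A p) p).
Proof. exact: chart_image_chart (chart_atP A p). Qed.

Lemma chart_image_openP i : open (chart_image i).
Proof. exact: chart_image_open. Qed.

(** Smoothness concerns [f \o chart_inv i]; near [p], composing with the chart gives back [f].
    Continuity then yields a maximum on the compact surface. *)
Lemma smooth_fun_continuous f : smooth_fun A f -> continuous f.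
Proof.
move=> sf p; set i := chart_at A p.
have ip : chart_dom i p := chart_atP A p.
have pK : f (chart_inv i (chart i p)) = f p by rewrite chartK.
have cF := cont_diff_on_continuous _ _ _ _ (sf i 0%N) (chart_image_chart _ _ ip).
have cFc : ((f \o chart_inv i) \o chart i) x @[x --> p] --> f p.
  by rewrite -pK; exact: cvg_comp (chart_continuous ip) cF.
apply: cvg_trans cFc.
have := @near_eq_cvg _ _ (nbhs p) (nbhs_filter p) ((f \o chart_inv i) \o chart i) f.
apply.
have : nbhs p (chart_dom i) by apply: open_nbhs_nbhs; split => //; exact: chart_dom_open.
by apply: filterS => q iq /=; rewrite chartK.
Qed.

Lemma smooth_funD f h : smooth_fun A f -> smooth_fun A h ->
  smooth_fun A (fun p => f p + h p).
Proof.
move=> sf sh i n.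
exact: cont_diff_onD (chart_image_openP i) (sf i n) (sh i n).
Qed.

Lemma smooth_funZ (c : R) f : smooth_fun A f -> smooth_fun A (fun p => c * f p).
Proof.
move=> sf i n.
have sc := cont_diff_on_cst n _ c (chart_image_openP i).
exact: cont_diff_onM (chart_image_openP i) sc (sf i n).
Qed.

Lemma laplacian_minus2D f h p : smooth_fun A f -> smooth_fun A h ->
  laplacian_minus2 g0 (fun q => f q + h q) p =
  laplacian_minus2 g0 f p + laplacian_minus2 g0 h p.
Proof.
move=> sf sh; rewrite /laplacian_minus2 /laplacian.
have /= -> := plane_laplacianD _ _ _ _ (chart_image_openP _) (chart_image_at p) (sf _ 2) (sh _ 2).
by rewrite mulrDl mulrDr opprD addrACA.
Qed.

Lemma laplacian_minus2Z (c : R) f p : smooth_fun A f ->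
  laplacian_minus2 g0 (fun q => c * f q) p = c * laplacian_minus2 g0 f p.
Proof.
move=> sf; rewrite /laplacian_minus2 /laplacian.
have /= -> := plane_laplacianZ _ c _ _ (chart_image_openP _) (chart_image_at p) (sf _ 2).
by rewrite mulrBr -mulrA [c * (2 * _)]mulrCA.
Qed.

Lemma maximum_principle f : compact [set: S] -> smooth_fun A f ->
  (forall p, 0 <= laplacian_minus2 g0 f p) -> forall p, f p <= 0.
Proof.
move=> cS sf sub p.
have [q _ qmax] := compact_EVT_max (ex_intro _ p I) cS
  (continuous_subspaceT (smooth_fun_continuous _ sf)).
apply: le_trans (qmax p (mem_set I)) _.
have := sub q; rewrite /laplacian_minus2 /laplacian.
set i := chart_at A q; set z := chart i q.
have iz : chart_image i z := chart_image_at q.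
have qK : f q = (f \o chart_inv i) z by rewrite /= chartK//; exact: chart_atP.
have zmax w : chart_image i w -> (f \o chart_inv i) w <= (f \o chart_inv i) z.
  by move=> _; rewrite -qK; apply: qmax; exact: mem_set.
have s2 := sf i 2; have oi := chart_image_openP i.
have lx := max_dpartial2_le0 _ _ _ _ is_line_x oi iz
  (has_partial_derivable _ _ _ _ (cont_diff_on_partial_x _ _ _ s2))
  (has_partial_derivable _ _ _ _ (cont_diff_on_partial_x _ _ _ (cont_diff_on_x _ _ _ s2))) zmax.
have ly := max_dpartial2_le0 _ _ _ _ is_line_y oi iz
  (has_partial_derivable _ _ _ _ (cont_diff_on_partial_y _ _ _ s2))
  (has_partial_derivable _ _ _ _ (cont_diff_on_partial_y _ _ _ (cont_diff_on_y _ _ _ s2))) zmax.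
have lap : plane_laplacian (f \o chart_inv i) z <= 0.
  by have := lerD lx ly; rewrite addr0.
have gz := conf_factor_gt0 g0 iz.
(* [H] reads 2 f q <= Delta f q: the zeroth-order term converts the sign of the Laplacian into a
   bound on the maximal value itself. *)
rewrite subr_ge0 => H.
have : 2 * f q <= 0.
  by apply: le_trans H _; rewrite pmulr_lle0 ?invr_gt0.
by rewrite pmulr_rle0.
Qed.

(** * The function |Phi|^2 / g0^2 on the surface *)

Context (Phi : holomorphic_quadratic_differential A).

(** The square root inside [normc] is expanded away, leaving products to which the differentiation
    rules apply even at zeros of Phi. *)
Definition local_norm2 i (w : plane R) : R :=
  let f := qd_coef Phi i in
  (complex.Re (f w) * complex.Re (f w) + complex.Im (f w) * complex.Im (f w)) *
  ((conf_factor g0 i w)^-1 * (conf_factor g0 i w)^-1).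

(** [qd_norm2] uses the chart chosen at each point, which may change with [w]; independence of the
    chart gives one formula on the whole image of chart [i], which can be differentiated. *)
Lemma qd_norm2_local i w : chart_image i w ->
  qd_norm2 g0 Phi (chart_inv i w) = local_norm2 i w.
Proof.
move=> [p ip <-]; rewrite chartK// (qd_norm2E g0 Phi ip) /local_norm2 /=.
case: (qd_coef Phi i (chart i p)) => a b /=.
by rewrite sqr_sqrtr ?addr_ge0 ?sqr_ge0// expr2 invfM -!expr2.
Qed.

Lemma smooth_qd_norm2 : smooth_fun A (qd_norm2 g0 Phi).
Proof.
move=> i n; have oi := chart_image_openP i.
apply: (cont_diff_on_eq _ _ (local_norm2 i) _ oi).
  by move=> w iw; rewrite /= qd_norm2_local.
have [sa sb _] := qd_coef_holomorphic Phi i.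
have gn0 w : chart_image i w -> conf_factor g0 i w != 0.
  by move=> iw; rewrite gt_eqF// conf_factor_gt0.
have sV := cont_diff_onV _ _ _ oi gn0 (conf_factor_smooth g0 i n).
apply: (cont_diff_onM _ _ _ _ oi _ (cont_diff_onM _ _ _ _ oi sV sV)).
exact: cont_diff_onD oi (cont_diff_onM _ _ _ _ oi (sa n) (sa n)) (cont_diff_onM _ _ _ _ oi (sb n) (sb n)).
Qed.

Lemma qd_norm2_ge0 p : 0 <= qd_norm2 g0 Phi p.
Proof. by rewrite divr_ge0 ?sqr_ge0. Qed.

Lemma laplacian_qd_norm2_ge p :
  - 4 * qd_norm2 g0 Phi p <= laplacian g0 (qd_norm2 g0 Phi) p.
Proof.
rewrite /laplacian; set i := chart_at A p; set z := chart i p.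
have iz : chart_image i z := chart_image_at p.
have gz := conf_factor_gt0 g0 iz.
have oi := chart_image_openP i.
rewrite (plane_laplacian_eq _ _ (local_norm2 i) _ oi iz); last first.
  by move=> w iw; rewrite /= qd_norm2_local.
rewrite ler_pdivlMr//.
have <- : local_norm2 i z = qd_norm2 g0 Phi p.
  by rewrite -qd_norm2_local// chartK//; exact: chart_atP.
rewrite mulrAC.
apply: (laplacian_conformal_norm_ge _ _ _ _ oi iz).
- exact: qd_coef_holomorphic.
- exact: conf_factor_smooth.
- by move=> w iw; exact: conf_factor_gt0.
- exact: conf_factor_curvature.
Qed.

End Surface.

Theorem lemma5p1 (R : realType) (S : topologicalType) (genus : nat)
    (A : conformal_atlas R S) (g0 : hyperbolic_metric A)
    (Phi : holomorphic_quadratic_differential A)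
    (S_compact : compact [set: S]) (S_hausdorff : hausdorff_space S)
    (S_connected : connected [set: S])
    (S_genus : has_genus R S genus) (genus_ge2 : (2 <= genus)%N) :
  let u : S -> R := qd_norm2 g0 Phi in
  let v : S -> R := fun p => 3^-1 * u p in
  subsolution g0 (fun p => - 2 * u p) v /\
  (forall p, 0 <= v p) /\
  (forall G : (S -> R) -> (S -> R), inverse_laplacian_minus2 g0 G ->
    forall p, v p <= - 2 * G u p).
Proof.
move=> u v.
have su : smooth_fun A u := smooth_qd_norm2 _ _ _.
have sv : smooth_fun A v := smooth_funZ _ _ _ su.
have sub p : - 2 * u p <= laplacian_minus2 g0 v p.
  rewrite laplacian_minus2Z// /laplacian_minus2.
  have := laplacian_qd_norm2_ge A g0 Phi p; rewrite -/u.
  by move: (laplacian g0 u p) (u p) => l x; lra.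
split; first by split.
split=> [p|G invG p]; first by rewrite mulr_ge0 ?invr_ge0// qd_norm2_ge0.
have [sG GE _] := invG u su.
have s2 := smooth_funZ _ 2 _ sG.
(* The bound -2 u for [v] is balanced exactly by the 2 u coming from [2 * G u]. *)
have sum p' : 0 <= laplacian_minus2 g0 (fun q => v q + 2 * G u q) p'.
  rewrite (laplacian_minus2D _ _ _ _ _ sv s2) (laplacian_minus2Z _ _ _ _ _ sG) GE.
  by have := sub p'; lra.
have := maximum_principle _ _ _ S_compact (smooth_funD _ _ _ sv s2) sum p.
by lra.
Qed.
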